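(* For every integer $n>1$ the following hold. (a) $$\sum_{m=1}^{n-1}\sigma'_{1,7}(m,n-m) = \frac{176 n^9 -480 n}{7680}\psi_{-1}(n) + \frac{n^7}{24}\psi_{1}(n) - \frac{n}{480}\psi_{7}(n).$$ (b) $$\sum_{m=1}^{n-1}\sigma'_{3,5}(m,n-m) = \frac{11 n^9}{5040}\psi_{-1}(n) - \frac{n^5}{240}\psi_{3}(n) + \frac{n^3}{504}\psi_{5}(n).$$
   Context: $\mathbb{N}$ denotes the set of positive integers and $\mathbb{N}_0=\mathbb{N}\cup\{0\}$. For $m,n\in\mathbb{N}$ and $r,s\in\mathbb{N}_0$, $$\sigma'_{r,s}(m,n)=\sum_{\substack{(d,e)\in\mathbb{N}^2\\ d\mid m,\ e\mid n\\ \gcd(d,e)=\gcd(m/d,\,n/e)=1}} d^r e^s.$$ For $n\in\mathbb{N}$ and $s\in\mathbb{Z}\setminus\{0\}$, $\psi_s(n)=\sum_{d\mid n}\mu(d)d^s$, where the sum is over positive divisors $d$ of $n$ and $\mu$ is the Möbius function. *)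

(* Defs.v *)
From mathcomp Require Import all_boot all_order all_algebra.

Set Implicit Arguments.
Unset Strict Implicit.
Unset Printing Implicit Defensive.

Import GRing.Theory.

Local Open Scope ring_scope.

(* All three functions are meant for positive m and n only: [divisors 0] and
   [primes 0] are empty lists by convention. *)

Definition sigma' (r s m n : nat) : nat :=
  (\sum_(d <- divisors m)
     \sum_(e <- divisors n | coprime d e && coprime (m %/ d) (n %/ e))
        d ^ r * e ^ s)%N.

Definition mobius (n : nat) : int :=
  if all (fun p => logn p n == 1%N) (primes n)
  then (-1) ^+ size (primes n) else 0.

Definition psi (s : int) (n : nat) : rat :=
  \sum_(d <- divisors n) (mobius d)%:~R * (d%:R : rat) ^ s.

(* Main.v *)
Require Import Defs.
From mathcomp Require Import all_boot all_order all_algebra.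
From mathcomp Require Import zify ring.

Set Implicit Arguments.
Unset Strict Implicit.
Unset Printing Implicit Defensive.

Import GRing.Theory.

Local Open Scope ring_scope.

(** The left-hand sides are sums over the quadruples (a, b, x, y) of positive
integers with a x + b y = n and gcd(a, b) = gcd(x, y) = 1, with summand
a^r b^s. On these quadruples the map

   (a, b, x, y) |-> (a, b - a, x + y, y)

is a bijection from those with a < b onto those with y < x, with inverse
(a, b, x, y) |-> (a, a + b, x - y, y) ([sum_rep_shift]). Let f be a symmetric
function with f(a, a + b) = f(b, a + b). Split the sum of f(a, b) by the order
of a and b, and the sum of f(a, a + b) by the order of x and y: the bijection
matches the parts off the diagonals. On the diagonals, a = b forces a = b = 1
and x = y forces x = y = 1, so that, for n > 1,

   sum of (f(a, b) - f(a, a + b)) over the quadruples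
     = sum of (f(1, 1) - f(a, n)) over the a < n coprime to n

([sum_rep_invariant]).

The homogeneous polynomials f of degree 8 with these two symmetries form a
space of dimension 2. It is spanned by x^8 + y^8 + (x - y)^8 ([pow8]) and
x^2 y^2 (x - y)^2 (x^2 - x y + y^2) ([inv8]). Since f(a, a + b) = f(a, - b),
the difference f(a, b) - f(a, a + b) has only terms of odd degree in a and in
b. For [inv8] it is -6 (a^3 b^5 + a^5 b^3), which gives (b); for
3 [pow8] - 56 [inv8] it is -48 (a b^7 + a^7 b), which gives (a).

It remains to sum a polynomial over the a coprime to n. Moebius inversion
([sum_coprime]) reduces this to power sums up to n / d for d dividing n, and
the resulting sums over d are values of [psi]. *)

(** * The Moebius function and sums over coprime residues *)

Lemma mobius_muln_prime p e :
  prime p -> (0 < e)%N -> ~~ (p %| e)%N -> mobius (p * e) = - mobius e.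
Proof.
move=> pr_p e_gt0 pNe; have p_gt0 := prime_gt0 pr_p.
have prE : perm_eq (primes (p * e)) (p :: primes e).
  apply: uniq_perm => [||q]; first exact: primes_uniq.
    by rewrite /= primes_uniq mem_primes pr_p e_gt0 (negPf pNe).
  by rewrite primesM // inE (primes_prime pr_p) inE.
rewrite /mobius (perm_size prE) (perm_all _ prE) /= lognM // logn_prime // eqxx.
have -> : logn p e = 0%N.
  by apply/eqP; rewrite -leqn0 leqNgt logn_gt0 mem_primes pr_p e_gt0.
rewrite addn0 /=.
have -> : all (fun q => logn q (p * e) == 1)%N (primes e)
        = all (fun q => logn q e == 1)%N (primes e).
  apply: eq_in_all => q; rewrite mem_primes => /and3P[pr_q _ qe].
  rewrite lognM // logn_prime //; case: (eqVneq q p) => // qp.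
  by rewrite -qp qe in pNe.
by case: ifP => _; rewrite ?oppr0 // exprS mulN1r.
Qed.

Lemma mobius_square_dvd p d :
  prime p -> (0 < d)%N -> (p ^ 2 %| d)%N -> mobius d = 0.
Proof.
move=> pr_p d_gt0 p2d; rewrite /mobius ifF //; apply/negbTE/allPn; exists p.
  by rewrite mem_primes pr_p d_gt0 (dvdn_trans _ p2d) // dvdn_exp.
by move: p2d; rewrite pfactor_dvdn //; case: (logn p d) => [|[]].
Qed.

(** For n > 1 and a prime p dividing n, the divisors d and p d with d prime to
p cancel each other, and the remaining divisors are multiples of p^2. *)
Lemma sum_mobius n : (0 < n)%N ->
  \sum_(d <- divisors n) mobius d = (n == 1%N)%:R.
Proof.
move=> n_gt0; case: eqP => [->|/eqP n_neq1]; first by rewrite big_seq1.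
have pr_p : prime (pdiv n) by rewrite pdiv_prime // ltn_neqAle eq_sym n_neq1.
have pn := pdiv_dvd n; move: (pdiv n) pr_p pn => p pr_p pn.
have p_gt0 := prime_gt0 pr_p.
have divE d : (d \in divisors n) = (d %| n)%N by rewrite dvdn_divisors.
rewrite (bigID (fun d => p %| d)%N) /=.
rewrite (bigID (fun d => p ^ 2 %| d)%N) /= big1_seq ?add0r; last first.
  move=> d /andP[/andP[_ p2d]]; rewrite divE => dn.
  exact: (mobius_square_dvd pr_p (dvdn_gt0 n_gt0 dn) p2d).
rewrite -big_filter -[X in _ + X]big_filter.
set s := [seq d <- _ | ~~ _].
rewrite (@perm_big _ _ _ _ _ [seq (p * e)%N | e <- s]).
  rewrite big_map -big_split /= big1_seq // => e /andP[_].
  rewrite mem_filter divE => /andP[pNe en].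
  by rewrite mobius_muln_prime ?addNr // (dvdn_gt0 n_gt0 en).
apply: uniq_perm => [||d]; first by rewrite filter_uniq // divisors_uniq.
  rewrite map_inj_uniq ?filter_uniq ?divisors_uniq // => x y /eqP.
  by rewrite eqn_pmul2l // => /eqP.
rewrite mem_filter divE; apply/idP/mapP => [/andP[/andP[pd p2d] dn]|[e]].
  exists (d %/ p)%N; last by rewrite mulnC divnK.
  rewrite mem_filter divE (dvdn_trans _ dn) ?dvdn_divl ?andbT; last first.
    by rewrite -{2}(divnK pd) dvdn_mulr.
  by apply: contra p2d; rewrite -{2}(divnK pd) expnS expn1 dvdn_pmul2r.
rewrite mem_filter divE => /andP[pNe en] ->.
rewrite dvdn_mulr //= expnS expn1 dvdn_pmul2l // pNe /= Gauss_dvd ?pn //.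
by rewrite prime_coprime.
Qed.

(** Moebius inversion of the condition that a is coprime to n. *)
Lemma sum_coprime (R : pzRingType) n (F : nat -> R) : (0 < n)%N ->
  \sum_(1 <= a < n.+1 | coprime a n) F a =
  \sum_(d <- divisors n)
     (mobius d)%:~R * \sum_(1 <= j < (n %/ d).+1) F (d * j)%N.
Proof.
move=> n_gt0.
transitivity (\sum_(d <- divisors n)
    \sum_(1 <= a < n.+1 | (d %| a)%N) (mobius d)%:~R * F a).
  rewrite (exchange_big_dep xpredT) //= big_mkcond.
  rewrite big_seq [RHS]big_seq; apply: eq_bigr => a;
    rewrite mem_index_iota => /andP[a_gt0 _].
  rewrite -mulr_suml -big_filter.
  rewrite (@perm_big _ _ _ _ _ (divisors (gcdn a n))).
    rewrite -rmorph_sum /= sum_mobius ?gcdn_gt0 ?a_gt0 // /coprime.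
    by case: eqP; rewrite ?mul1r ?mul0r.
  apply: uniq_perm; rewrite ?filter_uniq ?divisors_uniq // => d.
  by rewrite mem_filter -!dvdn_divisors ?gcdn_gt0 ?a_gt0 // dvdn_gcd.
rewrite big_seq [RHS]big_seq; apply: eq_bigr => d;
  rewrite -dvdn_divisors // => dn.
have d_gt0 := dvdn_gt0 n_gt0 dn.
rewrite -mulr_sumr -big_filter; congr (_ * _).
rewrite (@perm_big _ _ _ _ _ [seq (d * j)%N | j <- index_iota 1 (n %/ d).+1]).
  by rewrite big_map.
apply: uniq_perm => [||a]; first by rewrite filter_uniq // iota_uniq.
  rewrite map_inj_uniq ?iota_uniq // => x y /eqP.
  by rewrite eqn_pmul2l // => /eqP.
rewrite mem_filter mem_index_iota ltnS;
  apply/idP/mapP => [/and3P[da a_gt0 an]|[j]].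
  exists (a %/ d)%N; last by rewrite mulnC divnK.
  by rewrite mem_index_iota ltnS leq_div2r // divn_gt0 // dvdn_leq.
rewrite mem_index_iota ltnS leq_divRL // => /andP[j_gt0 jn] ->.
by rewrite dvdn_mulr // muln_gt0 d_gt0 j_gt0 mulnC.
Qed.

(** * Coprime representations of n *)

(** The quadruple (a, b, x, y) is encoded as ((a, b), (x, y)). *)
Definition quad : Type := ((nat * nat) * (nat * nat))%type.

(** The representations n = a x + b y in positive integers with a prime to b
and x prime to y. *)
Definition is_rep n (a b x y : nat) : bool :=
  [&& 0 < a, 0 < b, 0 < x, 0 < y, coprime a b, coprime x y
    & a * x + b * y == n]%N.

(** The list of these representations, in the form in which they are indexed by
the sum of the [sigma' r s m (n - m)]: (a, b) runs over the pairs of divisors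
of m and n - m, and (x, y) are the complementary divisors. *)
Definition rep (n : nat) : seq (nat * nat * (nat * nat)) :=
  [seq (de, (m %/ de.1, (n - m) %/ de.2))%N
     | m <- index_iota 1 n,
       de <- [seq de <- [seq (d, e) | d <- divisors m, e <- divisors (n - m)]
                | coprime de.1 de.2 && coprime (m %/ de.1) ((n - m) %/ de.2)]].

Lemma mem_rep n a b x y : ((a, b, (x, y)) \in rep n) = is_rep n a b x y.
Proof.
apply/allpairsPdep/idP => [[m [[d e]]]|].
  rewrite mem_index_iota mem_filter => -[/andP[m_gt0 mn] /= /andP[cop]].
  case/allpairsP=> -[d' e'] /= [+ + [? ?]]; subst d' e';
    have nm_gt0 : (0 < n - m)%N by rewrite subn_gt0.
  rewrite -!dvdn_divisors // => dm en [-> -> -> ->].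
  case/andP: cop => c1 c2;
    rewrite /is_rep c1 c2 !divn_gt0 ?(dvdn_leq _ dm) ?(dvdn_leq _ en) //;
    rewrite ?(dvdn_gt0 _ dm) ?(dvdn_gt0 _ en) //=.
  by rewrite mulnC divnK // mulnC divnK // subnKC // ltnW.
case/and5P=> a0 b0 x0 y0 /and3P[cab cxy /eqP defn].
have ax0 : (0 < a * x)%N by rewrite muln_gt0 a0.
have by0 : (0 < b * y)%N by rewrite muln_gt0 b0.
have nE : (n - a * x = b * y)%N by rewrite -defn addKn.
exists (a * x)%N, (a, b);
  rewrite mem_index_iota mem_filter /= nE !mulKn // cab cxy; split=> //.
  by rewrite ax0 -defn -addn1 leq_add2l.
by apply/allpairsP; exists (a, b); rewrite -!dvdn_divisors // !dvdn_mulr.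
Qed.

Lemma rep_uniq n : uniq (rep n).
Proof.
apply: allpairs_uniq_dep => [|m _|]; first exact: iota_uniq.
  rewrite filter_uniq // allpairs_uniq ?divisors_uniq // =>
    -[? ?] [? ?] _ _ [-> ->] //.
have K m de : m \in index_iota 1 n ->
    de \in [seq de <- [seq (d, e) | d <- divisors m, e <- divisors (n - m)]
                | coprime de.1 de.2 && coprime (m %/ de.1) ((n - m) %/ de.2)] ->
    m = (m %/ de.1 * de.1)%N.
  rewrite mem_index_iota mem_filter =>
    /andP[m_gt0 _] /andP[_ /allpairsP[[d e] /= [dm _ ->]]].
  by rewrite divnK // dvdn_divisors.
move=> u v /allpairsPdep[m [de [mi dei ->]]]
  /allpairsPdep[m' [de' [mi' dei' ->]]] /=.
move=> [Ede Eq _]; subst de'.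
by have -> : m = m' by rewrite (K _ _ mi dei) Eq -(K _ _ mi' dei').
Qed.

Lemma sum_sigma'_rep (R : pzSemiRingType) r s n :
  (\sum_(1 <= m < n) sigma' r s m (n - m))%N%:R =
  \sum_(q <- rep n) q.1.1%:R ^+ r * q.1.2%:R ^+ s :> R.
Proof.
rewrite big_allpairs_dep natr_sum; apply: eq_bigr => m _.
rewrite big_filter [RHS]big_mkcond big_allpairs natr_sum; apply: eq_bigr => d _.
rewrite natr_sum [LHS]big_mkcond; apply: eq_bigr => e _ /=.
by case: ifP => // _; rewrite natrM !natrX.
Qed.

(** The two symmetries of the set of representations: exchange of the two
products a x and b y, and exchange of the pairs (a, b) and (x, y). *)
Definition swap_rows (q : quad) : quad := ((q.1.2, q.1.1), (q.2.2, q.2.1)).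
Definition swap_cols (q : quad) : quad := (q.2, q.1).

Lemma swap_rowsK : involutive swap_rows. Proof. by case=> -[] ? ? []. Qed.
Lemma swap_colsK : involutive swap_cols. Proof. by case. Qed.

Lemma rep_swap_rows n q : (swap_rows q \in rep n) = (q \in rep n).
Proof.
case: q => -[a b] [x y];
  rewrite !mem_rep /is_rep coprime_sym [coprime y x]coprime_sym addnC.
by rewrite andbCA; do 2!congr (_ && _); rewrite andbCA.
Qed.

Lemma rep_swap_cols n q : (swap_cols q \in rep n) = (q \in rep n).
Proof.
case: q => -[a b] [x y];
  rewrite !mem_rep /is_rep [(x * a)%N]mulnC [(y * b)%N]mulnC.
by apply/and5P/and5P => -[-> -> -> -> /and3P[-> ->]].
Qed.

Lemma is_rep_shift n a b x y :
  is_rep n a b (x + y) y && (0 < x)%N = is_rep n a (a + b) x y && (0 < b)%N.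
Proof.
rewrite /is_rep /coprime [gcdn (x + y) y]gcdnC [gcdn x y]gcdnC gcdnDr gcdnDl.
have -> : (a * x + (a + b) * y = a * (x + y) + b * y)%N by lia.
by rewrite !addn_gt0; case: (0 < a)%N; case: (0 < b)%N; case: (0 < x)%N;
  case: (0 < y)%N; rewrite /= ?andbT ?andbF.
Qed.

(** * Sums over the representations *)

Section Sums.
Variable V : nmodType.
Implicit Types f : nat -> nat -> V.

Lemma sum_rep_involution n (t : quad -> quad) (P : pred quad) (F : quad -> V) :
  involutive t -> (forall q, (t q \in rep n) = (q \in rep n)) ->
  \sum_(q <- rep n | P q) F q = \sum_(q <- rep n | P (t q)) F (t q).
Proof.
move=> tK rep_t; rewrite (@perm_big _ _ _ _ _ (map t (rep n))) ?big_map //.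
have t_inj := inv_inj tK.
apply: uniq_perm; rewrite ?map_inj_uniq ?rep_uniq // => q.
by rewrite -[in RHS](tK q) mem_map // rep_t.
Qed.

(** The sum is reindexed by (a, b, x, y) |-> (a, a + b, x - y, y). *)
Lemma sum_rep_shift n f :
  \sum_(q <- rep n | (q.1.1 < q.1.2)%N) f q.1.1 q.1.2 =
  \sum_(q <- rep n | (q.2.2 < q.2.1)%N) f q.1.1 (q.1.1 + q.1.2)%N.
Proof.
pose h (q : quad) := ((q.1.1, (q.1.1 + q.1.2)%N), ((q.2.1 - q.2.2)%N, q.2.2)).
rewrite -big_filter -[RHS]big_filter.
rewrite (@perm_big _ _ _ _ _
  (map h [seq q <- rep n | (q.2.2 < q.2.1)%N])) ?big_map //.
apply: uniq_perm; rewrite ?filter_uniq ?rep_uniq //.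
  rewrite map_inj_in_uniq ?filter_uniq ?rep_uniq // =>
    -[[a b] [x y]] [[a' b'] [x' y']].
  rewrite !mem_filter /= => /andP[xy _] /andP[xy' _] [<- Eb Ex Ey].
  by congr (_, _, (_, _)); lia.
move=> [[a c] [z y]]; rewrite mem_filter mem_rep /=;
  apply/idP/mapP => [|[[[a' b] [x y']]]].
  move=> /andP[ac repc]; exists ((a, c - a), (z + y, y))%N; last first.
    by rewrite /h /= addnK subnKC // ltnW.
  have z0 : (0 < z)%N by case/and5P: repc.
  rewrite mem_filter mem_rep /= -{1}[y]add0n ltn_add2r z0.
  by have /andP[] : is_rep n a (c - a) (z + y) y && (0 < z)%N
    by rewrite is_rep_shift subn_gt0 ac (subnKC (ltnW ac)) repc.
rewrite mem_filter mem_rep /h /= => /andP[yx repb] [-> -> -> ->].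
have b0 : (0 < b)%N by case/and5P: repb.
rewrite -{1}[a']addn0 ltn_add2l b0 /=.
have /andP[] // : is_rep n a' (a' + b) (x - y') y' && (0 < b)%N.
by rewrite -is_rep_shift subn_gt0 yx (subnK (ltnW yx)) repb.
Qed.

(** The representations with x = y have x = y = 1, hence b = n - a with a prime
to n. *)
Lemma sum_rep_diag n (F : quad -> V) : (1 < n)%N ->
  \sum_(q <- rep n | q.2.1 == q.2.2) F q =
  \sum_(1 <= a < n.+1 | coprime a n) F ((a, n - a), (1, 1))%N.
Proof.
move=> n_gt1; pose h a : quad := ((a, n - a), (1, 1))%N.
rewrite -big_filter -[RHS]big_filter.
rewrite (@perm_big _ _ _ _ _
  (map h [seq a <- index_iota 1 n.+1 | coprime a n])) ?big_map //.
apply: uniq_perm; rewrite ?filter_uniq ?rep_uniq //.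
  by rewrite map_inj_uniq ?filter_uniq ?iota_uniq // => a a' [].
move=> [[a b] [x y]]; rewrite mem_filter mem_rep /=;
  apply/idP/mapP => [/andP[/eqP<-]|[a']].
  case/and5P=> a0 b0 x0 _ /and3P[cab]; rewrite /coprime gcdnn => /eqP x1 /eqP.
  rewrite x1 !muln1 => defn; exists a; last by rewrite /h -defn addKn.
  by rewrite mem_filter mem_index_iota a0 -defn ltnS leq_addr
    /coprime gcdnDl !andbT.
rewrite mem_filter mem_index_iota ltnS => /and3P[can a0 an] [-> -> -> ->] /=.
have an' : (a' < n)%N.
  by rewrite ltn_neqAle an andbT; apply: contraTneq can => ->;
    rewrite /coprime gcdnn gtn_eqF.
rewrite /is_rep a0 subn_gt0 an' !muln1 subnKC // eqxx andbT /= andbT.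
by rewrite /coprime -gcdnDl subnKC.
Qed.

Lemma sum_trichotomy (I : Type) (s : seq I) (u v : I -> nat) (F : I -> V) :
  \sum_(i <- s) F i = \sum_(i <- s | u i == v i) F i
    + (\sum_(i <- s | (u i < v i)%N) F i + \sum_(i <- s | (v i < u i)%N) F i).
Proof.
rewrite (big_mkcond (fun i => u i == v i)) (big_mkcond (fun i => u i < v i)%N).
rewrite (big_mkcond (fun i => v i < u i)%N) -!big_split /=;
  apply: eq_bigr => i _.
by case: ltngtP; rewrite ?add0r ?addr0.
Qed.

End Sums.

(** The main identity. The term a = n of the right-hand side is absent because
n > 1 is not coprime to itself. *)
Lemma sum_rep_invariant (V : zmodType) n (f : nat -> nat -> V) : (1 < n)%N ->
  (forall a b, f a b = f b a) ->
  (forall a b, f a (a + b)%N = f b (a + b)%N) ->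
  \sum_(q <- rep n) (f q.1.1 q.1.2 - f q.1.1 (q.1.1 + q.1.2)%N) =
  \sum_(1 <= a < n.+1 | coprime a n) (f 1%N 1%N - f a n).
Proof.
move=> n_gt1 fC fS.
rewrite !sumrB (@sum_trichotomy _ _ _ (fun q => q.1.1) (fun q => q.1.2)).
rewrite (@sum_trichotomy _ _ _ (fun q => q.2.2) (fun q => q.2.1)
  (fun q => f _ (_ + _)%N)).
have -> : \sum_(q <- rep n | (q.1.2 < q.1.1)%N) f q.1.1 q.1.2 =
          \sum_(q <- rep n | (q.2.1 < q.2.2)%N) f q.1.1 (q.1.1 + q.1.2)%N.
  rewrite (sum_rep_involution _ _ swap_rowsK (@rep_swap_rows n)) /=.
  rewrite (sum_rep_shift n (fun a b => f b a)).
  rewrite [RHS](sum_rep_involution _ _ swap_rowsK (@rep_swap_rows n)) /=.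
  by apply: eq_bigr => q _; rewrite fC addnC fS addnC.
(* The off-diagonal parts cancel; the two diagonals remain. *)
rewrite sum_rep_shift opprD addrACA subrr addr0; congr (_ - _).
  rewrite (sum_rep_involution _ _ swap_colsK (@rep_swap_cols n)) /=.
  exact: (sum_rep_diag (fun q => f q.2.1 q.2.2)).
under eq_bigl do rewrite eq_sym.
rewrite (sum_rep_diag (fun q => f q.1.1 (q.1.1 + q.1.2)%N)) //.
rewrite big_seq_cond [RHS]big_seq_cond; apply: eq_bigr => a.
by rewrite mem_index_iota ltnS => /andP[/andP[_ an] _] /=; rewrite subnKC.
Qed.

(** * Invariant polynomials of degree 8 and their sums *)

(** Two polynomials which are invariant under (x, y) |-> (y, x) and
(x, y) |-> (y - x, y). *)
Definition inv8 (x y : rat) : rat :=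
  x ^+ 2 * y ^+ 2 * (x - y) ^+ 2 * (x ^+ 2 - x * y + y ^+ 2).
Definition pow8 (x y : rat) : rat := x ^+ 8 + y ^+ 8 + (x - y) ^+ 8.

Lemma sum_closed_form (F G : rat -> rat) N :
  G 0 = 0 -> (forall x, G (x + 1) = G x + F (x + 1)) ->
  \sum_(1 <= j < N.+1) F j%:R = G N%:R.
Proof.
move=> G0 GS; elim: N => [|N IH]; first by rewrite big_geq.
by rewrite big_nat_recr //= IH -addn1 natrD GS.
Qed.

(** [Pk x] is the polynomial whose value at a natural number N is the sum of
the j^k for 1 <= j <= N. *)
Definition P2 (x : rat) := x ^+ 3 / 3%:R + x ^+ 2 / 2%:R + x / 6%:R.
Definition P3 (x : rat) := x ^+ 4 / 4%:R + x ^+ 3 / 2%:R + x ^+ 2 / 4%:R.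
Definition P4 (x : rat) :=
  x ^+ 5 / 5%:R + x ^+ 4 / 2%:R + x ^+ 3 / 3%:R - x / 30%:R.
Definition P5 (x : rat) :=
  x ^+ 6 / 6%:R + x ^+ 5 / 2%:R + 5%:R * x ^+ 4 / 12%:R - x ^+ 2 / 12%:R.
Definition P6 (x : rat) :=
  x ^+ 7 / 7%:R + x ^+ 6 / 2%:R + x ^+ 5 / 2%:R - x ^+ 3 / 6%:R + x / 42%:R.
Definition P8 (x : rat) :=
  x ^+ 9 / 9%:R + x ^+ 8 / 2%:R + 2%:R * x ^+ 7 / 3%:R - 7%:R * x ^+ 5 / 15%:R
  + 2%:R * x ^+ 3 / 9%:R - x / 30%:R.

Lemma sum_inv8 N : let y := N%:R in
  \sum_(1 <= j < N.+1) inv8 j%:R y =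
    11%:R / 420%:R * y ^+ 9 - 1 / 20%:R * y ^+ 5 + 1 / 42%:R * y ^+ 3.
Proof.
move=> y.
(* Up to the factor y^2, inv8 x y is
   y^4 x^2 - 3 y^3 x^3 + 4 y^2 x^4 - 3 y x^5 + x^6. *)
rewrite (@sum_closed_form (fun x => inv8 x y) (fun x => y ^+ 2 *
  (y ^+ 4 * P2 x - 3%:R * y ^+ 3 * P3 x + 4%:R * y ^+ 2 * P4 x
   - 3%:R * y * P5 x + P6 x))).
- by rewrite -/y /P2 /P3 /P4 /P5 /P6; field.
- by rewrite /P2 /P3 /P4 /P5 /P6; field.
by move=> x; rewrite /inv8 /P2 /P3 /P4 /P5 /P6; field.
Qed.

Lemma sum_pow8 N : let y := N%:R in
  \sum_(1 <= j < N.+1) pow8 j%:R y =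
    11%:R / 9%:R * y ^+ 9 + 4%:R / 3%:R * y ^+ 7 - 14%:R / 15%:R * y ^+ 5
    + 4%:R / 9%:R * y ^+ 3 - 1 / 15%:R * y.
Proof.
move=> y.
(* The sum of the (y - j)^8 for j <= x is a difference of two values of P8. *)
rewrite (@sum_closed_form (fun x => pow8 x y)
  (fun x => P8 x + x * y ^+ 8 + P8 (y - 1) - P8 (y - x - 1))).
- by rewrite -/y /P8; field.
(* At 0 the two shifted terms cancel. *)
- by rewrite /P8; field.
by move=> x; rewrite /pow8 /P8; field.
Qed.

Lemma sum_coprime_homogeneous k (F : rat -> rat -> rat) n : (0 < n)%N ->
  (forall c x y, F (c * x) (c * y) = c ^+ k * F x y) ->
  \sum_(1 <= a < n.+1 | coprime a n) F a%:R n%:R =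
  \sum_(d <- divisors n) (mobius d)%:~R *
    (d%:R ^+ k * \sum_(1 <= j < (n %/ d).+1) F j%:R (n %/ d)%N%:R).
Proof.
move=> n_gt0 Fk; rewrite (sum_coprime (fun a => F a%:R n%:R)) //.
rewrite big_seq [RHS]big_seq; apply: eq_bigr => d;
  rewrite -dvdn_divisors // => dn.
rewrite [in RHS]mulr_sumr; congr (_ * _); apply: eq_bigr => j _.
by rewrite -Fk -!natrM [(d * (n %/ d))%N]mulnC divnK.
Qed.

(** The sum of mu(d) d^8 (n / d)^k over the divisors d of n is n^k times the
value of [psi] of index 8 - k. *)
Lemma sum_coprime_psi (F : rat -> rat -> rat) (c9 c7 c5 c3 c1 : rat) n :
  (0 < n)%N -> (forall c x y, F (c * x) (c * y) = c ^+ 8 * F x y) ->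
  (forall N, let y := N%:R in \sum_(1 <= j < N.+1) F j%:R y =
     c9 * y ^+ 9 + c7 * y ^+ 7 + c5 * y ^+ 5 + c3 * y ^+ 3 + c1 * y) ->
  \sum_(1 <= a < n.+1 | coprime a n) F a%:R n%:R =
  c9 * n%:R ^+ 9 * psi (-1) n + c7 * n%:R ^+ 7 * psi 1 n
  + c5 * n%:R ^+ 5 * psi 3 n + c3 * n%:R ^+ 3 * psi 5 n
  + c1 * n%:R * psi 7 n.
Proof.
move=> n_gt0 F8 sumF; rewrite (sum_coprime_homogeneous n_gt0 F8).
rewrite /psi !mulr_sumr -!big_split /=.
apply: eq_big_seq => d; rewrite -dvdn_divisors // => dn.
have d_neq0 : (d%:R : rat) != 0.
  by rewrite Num.Theory.pnatr_eq0 -lt0n (dvdn_gt0 n_gt0 dn).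
have -> : n%:R = d%:R * (n %/ d)%N%:R :> rat.
  by rewrite -natrM mulnC divnK.
rewrite sumF exprN1 -!exprnP.
by field.
Qed.

Lemma sum_coprime_pow8 n : (0 < n)%N ->
  \sum_(1 <= a < n.+1 | coprime a n) pow8 a%:R n%:R =
  11%:R / 9%:R * n%:R ^+ 9 * psi (-1) n + 4%:R / 3%:R * n%:R ^+ 7 * psi 1 n
  - 14%:R / 15%:R * n%:R ^+ 5 * psi 3 n + 4%:R / 9%:R * n%:R ^+ 3 * psi 5 n
  - 1 / 15%:R * n%:R * psi 7 n.
Proof.
move=> n_gt0.
rewrite (@sum_coprime_psi _ (11%:R / 9%:R) (4%:R / 3%:R) (- 14%:R / 15%:R)
  (4%:R / 9%:R) (- 1 / 15%:R)) //.
- move: (psi _ n) (psi 1 n) (psi 3 n) (psi 5 n) (psi 7 n) => p q r s t.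
  by field.
- by move=> c x y; rewrite /pow8; ring.
by move=> N y; rewrite sum_pow8 -/y; field.
Qed.

Lemma sum_coprime_inv8 n : (0 < n)%N ->
  \sum_(1 <= a < n.+1 | coprime a n) inv8 a%:R n%:R =
  11%:R / 420%:R * n%:R ^+ 9 * psi (-1) n - 1 / 20%:R * n%:R ^+ 5 * psi 3 n
  + 1 / 42%:R * n%:R ^+ 3 * psi 5 n.
Proof.
move=> n_gt0.
rewrite (@sum_coprime_psi _ (11%:R / 420%:R) 0 (- 1 / 20%:R) (1 / 42%:R) 0) //.
- move: (psi _ n) (psi 1 n) (psi 3 n) (psi 5 n) (psi 7 n) => p q r s t.
  by field.
- by move=> c x y; rewrite /inv8; ring.
by move=> N y; rewrite sum_inv8 -/y; field.
Qed.

Lemma count_coprime_psi n : (0 < n)%N ->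
  \sum_(1 <= a < n.+1 | coprime a n) 1 = n%:R * psi (-1) n.
Proof.
move=> n_gt0; rewrite sum_coprime // mulr_sumr; apply: eq_big_seq => d.
rewrite -dvdn_divisors // => dn; rewrite sumr_const_nat subn1 exprN1 mulrCA.
have d_neq0 : (d%:R : rat) != 0.
  by rewrite Num.Theory.pnatr_eq0 -lt0n (dvdn_gt0 n_gt0 dn).
by congr (_ * _); rewrite -{2}(divnK dn) natrM mulfK.
Qed.

(** * Reduction of the two convolution sums to sums over coprime residues *)

Lemma sum_rep_monomial_swap (R : pzSemiRingType) r s n :
  \sum_(q <- rep n)
    (q.1.1%:R ^+ r * q.1.2%:R ^+ s + q.1.1%:R ^+ s * q.1.2%:R ^+ r) =
  ((\sum_(1 <= m < n) sigma' r s m (n - m))%N%:R : R) *+ 2.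
Proof.
rewrite big_split /= mulr2n sum_sigma'_rep; congr (_ + _).
rewrite (sum_rep_involution _ _ swap_rowsK (@rep_swap_rows n)) /=.
by apply: eq_bigr => q _; rewrite -!natrX -!natrM mulnC.
Qed.

Lemma convolution35_coprime n : (1 < n)%N ->
  12%:R * (\sum_(1 <= m < n) sigma' 3 5 m (n - m))%N%:R =
  \sum_(1 <= a < n.+1 | coprime a n) inv8 a%:R n%:R.
Proof.
move=> n_gt1; pose f a b := inv8 a%:R b%:R.
have fC a b : f a b = f b a by rewrite /f /inv8; ring.
have fS a b : f a (a + b)%N = f b (a + b)%N by rewrite /f /inv8 natrD; ring.
have fB a b : f a b - f a (a + b)%N =
    - 6%:R * (a%:R ^+ 3 * b%:R ^+ 5 + a%:R ^+ 5 * b%:R ^+ 3).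
  by rewrite /f /inv8 natrD; ring.
have := sum_rep_invariant n_gt1 fC fS.
rewrite (eq_bigr _ (fun q _ => fB q.1.1 q.1.2)).
rewrite -mulr_sumr sum_rep_monomial_swap sumrB.
have -> : f 1%N 1%N = 0 by rewrite /f /inv8; ring.
rewrite big1_eq sub0r => E; apply: oppr_inj; rewrite -E; ring.
Qed.

Lemma convolution17_coprime n : (1 < n)%N ->
  96%:R * (\sum_(1 <= m < n) sigma' 1 7 m (n - m))%N%:R =
  3%:R * (\sum_(1 <= a < n.+1 | coprime a n) pow8 a%:R n%:R)
  - 56%:R * (\sum_(1 <= a < n.+1 | coprime a n) inv8 a%:R n%:R)
  - 6%:R * (\sum_(1 <= a < n.+1 | coprime a n) 1).
Proof.
move=> n_gt1; pose f a b := 3%:R * pow8 a%:R b%:R - 56%:R * inv8 a%:R b%:R.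
have fC a b : f a b = f b a by rewrite /f /inv8 /pow8; ring.
have fS a b : f a (a + b)%N = f b (a + b)%N.
  by rewrite /f /inv8 /pow8 natrD; ring.
have fB a b : f a b - f a (a + b)%N =
    - 48%:R * (a%:R ^+ 1 * b%:R ^+ 7 + a%:R ^+ 7 * b%:R ^+ 1).
  by rewrite /f /inv8 /pow8 natrD; ring.
have := sum_rep_invariant n_gt1 fC fS.
rewrite (eq_bigr _ (fun q _ => fB q.1.1 q.1.2)).
rewrite -mulr_sumr sum_rep_monomial_swap sumrB.
have -> : f 1%N 1%N = 6%:R * 1 by rewrite /f /inv8 /pow8; ring.
have solve (S A B C : rat) : - 48%:R * (S *+ 2) =
    6%:R * C - (3%:R * A - 56%:R * B) ->
    96%:R * S = 3%:R * A - 56%:R * B - 6%:R * C.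
  move=> E; have -> : 96%:R * S = - (- 48%:R * (S *+ 2)) by ring.
  by rewrite E; ring.
by rewrite /f sumrB -!mulr_sumr => /solve.
Qed.

Theorem theorem5 (n : nat) (hn : (1 < n)%N) :
  (((\sum_(1 <= m < n) sigma' 1 7 m (n - m))%N%:R : rat) =
     (176%:R * n%:R ^+ 9 - 480%:R * n%:R) / 7680%:R * psi (-1) n
     + n%:R ^+ 7 / 24%:R * psi 1 n
     - n%:R / 480%:R * psi 7 n)
  /\
  (((\sum_(1 <= m < n) sigma' 3 5 m (n - m))%N%:R : rat) =
     11%:R * n%:R ^+ 9 / 5040%:R * psi (-1) n
     - n%:R ^+ 5 / 240%:R * psi 3 n
     + n%:R ^+ 3 / 504%:R * psi 5 n).
Proof.
have n_gt0 := ltnW hn.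
have cancel (c S T : rat) : c != 0 -> c * S = T -> S = T / c.
  by move=> c_neq0 <-; rewrite mulrC mulKf.
split.
- rewrite (cancel 96%:R _ _ _ (convolution17_coprime hn)) //.
  rewrite sum_coprime_pow8 // sum_coprime_inv8 // count_coprime_psi //.
  by field.
rewrite (cancel 12%:R _ _ _ (convolution35_coprime hn)) //.
rewrite sum_coprime_inv8 //.
by field.
Qed.
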